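(* Let $\mathscr{V}=(S_1,\dots,S_8)$ be any admissibly ordered orthoplicial Platonic configuration, with inversive coordinate vectors $\boldsymbol{v}_k=\boldsymbol{v}(S_k)$ and antipodal vector $\boldsymbol{v}_\mu=\tfrac12(\boldsymbol{v}_1+\boldsymbol{v}_5)$. Then $$\boldsymbol{v}_\mu=\tfrac12(\boldsymbol{v}_1+\boldsymbol{v}_5)=\tfrac12(\boldsymbol{v}_2+\boldsymbol{v}_6)=\tfrac12(\boldsymbol{v}_3+\boldsymbol{v}_7)=\tfrac12(\boldsymbol{v}_4+\boldsymbol{v}_8).$$ Hence the $V$-matrix $\boldsymbol{V}=\boldsymbol{V}(\mathscr{V})$ and the $F$-matrix $\boldsymbol{F}=\boldsymbol{F}(\mathscr{V})$ satisfy $\boldsymbol{V}=\boldsymbol{D}\boldsymbol{F}$, where $$\boldsymbol{D}=\begin{pmatrix}1&0&0&0&0\\0&1&0&0&0\\0&0&1&0&0\\0&0&0&1&0\\-1&0&0&0&2\\0&-1&0&0&2\\0&0&-1&0&2\\0&0&0&-1&2\end{pmatrix}.$$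
   Context: Work in $\hat{\mathbb{R}}^3=\mathbb{R}^3\cup\{\infty\}$. A ''sphere'' $S$ means a Euclidean sphere, or a plane (with $\infty$ added), together with a choice of orienting region $B$, one of the two components of its complement. Its inversive coordinate vector $\boldsymbol{v}(S)=(a,b,\hat x,\hat y,\hat z)$ (a row vector) is: for a Euclidean sphere with center $\boldsymbol{c}$ and oriented radius $r$ ($r>0$ if $B$ is the ball, $r<0$ if $B$ is the exterior), $b=1/r$ (the bend), $a=b|\boldsymbol{c}|^2-1/b$, and $(\hat x,\hat y,\hat z)=b\,\boldsymbol{c}$; for a plane $\{\boldsymbol{n}\cdot\boldsymbol{x}=h\}$ with $\boldsymbol{n}$ the unit normal pointing into $B$, $\boldsymbol{v}(S)=(2h,0,n_x,n_y,n_z)$. Möbius transformations of $\hat{\mathbb{R}}^3$ (all conformal and anti-conformal transformations) act on oriented spheres by mapping $(S,B)$ to its image. The standard configuration $\mathscr{V}_0=(S_1,\dots,S_8)$ consists of the spheres with inversive coordinates $(2,0,0,0,1)$, $(2,0,0,0,-1)$, $(1,1,\sqrt2,0,0)$, $(1,1,0,\sqrt2,0)$, $(0,2,0,0,-1)$, $(0,2,0,0,1)$, $(1,1,-\sqrt2,0,0)$, $(1,1,0,-\sqrt2,0)$, in this order. An orthoplicial Platonic configuration is the image of $\mathscr{V}_0$ under a Möbius transformation. An ordering $S_1,\dots,S_8$ of its spheres is admissible if distinct $S_i,S_j$ are tangent when $i\not\equiv j\pmod 4$ and disjoint when $i\equiv j\pmod 4$. The $V$-matrix of an admissibly ordered configuration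 is the $8\times5$ matrix with rows $\boldsymbol{v}_1,\dots,\boldsymbol{v}_8$; the $F$-matrix is the $5\times5$ matrix with rows $\boldsymbol{v}_1,\boldsymbol{v}_2,\boldsymbol{v}_3,\boldsymbol{v}_4,\boldsymbol{v}_\mu$. *)

(* Defs.v *)
From HB Require Import structures.
From mathcomp Require Import all_boot all_order all_algebra.
From mathcomp Require Import all_classical reals.
From mathcomp Require Import ring lra.

Set Implicit Arguments.
Unset Strict Implicit.
Unset Printing Implicit Defensive.

Import Order.TTheory GRing.Theory Num.Theory.

Local Open Scope classical_set_scope.
Local Open Scope ring_scope.

(* The norm of 'rV[R]_3 in MathComp-Analysis is the sup norm, so Euclidean
   geometry is set up from the dot product. *)
Definition dot (R : realType) (x y : 'rV[R]_3) : R :=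
  \sum_(i < 3) x 0 i * y 0 i.

(* The one-point extension of R^3; [None] is the point at infinity. *)
Notation hatR3 R := (option 'rV[R]_3).

(* An oriented sphere is a pair (S, B): a surface S and an orienting region B.
   The pairs which really are oriented spheres are exactly those with an
   inversive coordinate vector, cf. [inversive_coords]. *)
Notation osphere R := (set (hatR3 R) * set (hatR3 R))%type.

Definition eucl_sphere (R : realType) (c : 'rV[R]_3) (r : R) : osphere R :=
  (Some @` [set x | dot (x - c) (x - c) = r ^+ 2],
   if 0 < r then Some @` [set x | dot (x - c) (x - c) < r ^+ 2]
   else None |` (Some @` [set x | r ^+ 2 < dot (x - c) (x - c)])).

Definition oplane (R : realType) (n : 'rV[R]_3) (h : R) : osphere R :=
  (None |` (Some @` [set x | dot n x = h]), Some @` [set x | h < dot n x]).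

Definition coord_vec (R : realType) (a b : R) (w : 'rV[R]_3) : 'rV[R]_5 :=
  \row_(j < 5) [:: a; b; w 0 (inord 0); w 0 (inord 1); w 0 (inord 2)]`_j.

Inductive inversive_coords (R : realType) : osphere R -> 'rV[R]_5 -> Prop :=
| Inv_eucl (c : 'rV[R]_3) (r : R) of r != 0 :
    inversive_coords (eucl_sphere c r)
      (let b := r^-1 in coord_vec (b * dot c c - b^-1) b (b *: c))
| Inv_plane (n : 'rV[R]_3) (h : R) of dot n n = 1 :
    inversive_coords (oplane n h) (coord_vec (2 * h) 0 n).

(* Coordinates of an oriented sphere are unique ([inversive_vecP] below); the
   default 0 is only returned on pairs that are not oriented spheres. *)
Definition inversive_vec (R : realType) (s : osphere R) : 'rV[R]_5 :=
  xget 0 [set v | inversive_coords s v].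

Definition sphere_inversion (R : realType) (c : 'rV[R]_3) (r : R)
    (p : hatR3 R) : hatR3 R :=
  if p is Some x then
    if x == c then None
    else Some (c + (r ^+ 2 / dot (x - c) (x - c)) *: (x - c))
  else Some c.

Definition plane_reflection (R : realType) (n : 'rV[R]_3) (h : R)
    (p : hatR3 R) : hatR3 R :=
  if p is Some x then Some (x - (2 * (dot n x - h)) *: n) else None.

(* The full Moebius group (orientation-preserving and -reversing maps) is
   generated by the inversions in spheres and the reflections in planes. *)
Inductive moebius (R : realType) : (hatR3 R -> hatR3 R) -> Prop :=
| Moebius_id : moebius id
| Moebius_inversion (c : 'rV[R]_3) (r : R) (f : hatR3 R -> hatR3 R) of
    0 < r & moebius f : moebius (sphere_inversion c r \o f)
| Moebius_reflection (n : 'rV[R]_3) (h : R) (f : hatR3 R -> hatR3 R) of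
    dot n n = 1 & moebius f : moebius (plane_reflection n h \o f).

Definition sphere_image (R : realType) (f : hatR3 R -> hatR3 R)
    (s : osphere R) : osphere R := (f @` s.1, f @` s.2).

Definition seq_mx (R : realType) (m n : nat) (s : seq (seq R)) : 'M[R]_(m, n) :=
  \matrix_(i < m, j < n) (nth [::] s i)`_j.

Definition std_mx (R : realType) : 'M[R]_(8, 5) :=
  let q := Num.sqrt 2 in
  seq_mx 8 5
   [:: [:: 2; 0;   0;   0;  1];
       [:: 2; 0;   0;   0; -1];
       [:: 1; 1;   q;   0;  0];
       [:: 1; 1;   0;   q;  0];
       [:: 0; 2;   0;   0; -1];
       [:: 0; 2;   0;   0;  1];
       [:: 1; 1; - q;   0;  0];
       [:: 1; 1;   0; - q;  0]].

Definition std_config (R : realType) : set (osphere R) :=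
  [set s | exists k, inversive_coords s (row k (std_mx R))].

Definition orthoplicial (R : realType) (C : set (osphere R)) : Prop :=
  exists2 f, moebius f & C = sphere_image f @` @std_config R.

(* Tangency and disjointness concern the surfaces, not the regions; two
   parallel planes are tangent at infinity. *)
Definition tangent (R : realType) (s t : osphere R) : Prop :=
  exists p, s.1 `&` t.1 = [set p].

Definition disjoint_spheres (R : realType) (s t : osphere R) : Prop :=
  s.1 `&` t.1 = set0.

(* The spheres S_1, ..., S_8 are indexed by 0, ..., 7. *)
Definition admissible_ordering (R : realType) (C : set (osphere R))
    (S : 'I_8 -> osphere R) : Prop :=
  set_bij [set: 'I_8] C S /\
  forall i j : 'I_8, i != j ->
    if (i == j %[mod 4])%N then disjoint_spheres (S i) (S j)
    else tangent (S i) (S j).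

Definition antipodal_vec (R : realType) (S : 'I_8 -> osphere R) : 'rV[R]_5 :=
  2^-1 *: (inversive_vec (S (inord 0)) + inversive_vec (S (inord 4))).

Definition V_mx (R : realType) (S : 'I_8 -> osphere R) : 'M[R]_(8, 5) :=
  \matrix_(k < 8) inversive_vec (S k).

Definition F_mx (R : realType) (S : 'I_8 -> osphere R) : 'M[R]_5 :=
  \matrix_(k < 5)
    if (k < 4)%N then inversive_vec (S (inord k)) else antipodal_vec S.

Definition D_mx (R : realType) : 'M[R]_(8, 5) :=
  seq_mx 8 5
   [:: [::  1;  0;  0;  0; 0];
       [::  0;  1;  0;  0; 0];
       [::  0;  0;  1;  0; 0];
       [::  0;  0;  0;  1; 0];
       [:: -1;  0;  0;  0; 2];
       [::  0; -1;  0;  0; 2];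
       [::  0;  0; -1;  0; 2];
       [::  0;  0;  0; -1; 2]].

Lemma dotE (R : realType) (x y : 'rV[R]_3) :
  dot x y = x 0 (inord 0) * y 0 (inord 0) + x 0 (inord 1) * y 0 (inord 1)
            + x 0 (inord 2) * y 0 (inord 2).
Proof.
by rewrite /dot !big_ord_recl big_ord0 addr0 addrA;
  congr (_ * _ + _ * _ + _ * _); congr (_ 0 _); apply/val_inj; rewrite /= inordK.
Qed.

Lemma dotC (R : realType) (x y : 'rV[R]_3) : dot x y = dot y x.
Proof. by rewrite !dotE; ring. Qed.

Lemma dotDr (R : realType) (x y z : 'rV[R]_3) :
  dot x (y + z) = dot x y + dot x z.
Proof. by rewrite !dotE !mxE; ring. Qed.

Lemma dotZr (R : realType) (k : R) (x y : 'rV[R]_3) :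
  dot x (k *: y) = k * dot x y.
Proof. by rewrite !dotE !mxE; ring. Qed.

Lemma dotBr (R : realType) (x y z : 'rV[R]_3) :
  dot x (y - z) = dot x y - dot x z.
Proof. by rewrite !dotE !mxE; ring. Qed.

Lemma dot_sqrD (R : realType) (x y : 'rV[R]_3) :
  dot (x + y) (x + y) = dot x x + 2 * dot x y + dot y y.
Proof. by rewrite !dotE !mxE; ring. Qed.

Lemma dot_eq0 (R : realType) (x : 'rV[R]_3) : dot x x = 0 -> x = 0.
Proof.
move=> /eqP; rewrite psumr_eq0; last by move=> i _; rewrite -expr2 sqr_ge0.
move=> /allP h; apply/rowP => i; rewrite mxE; apply/eqP.
by have := h i (mem_index_enum i); rewrite /= mulf_eq0 orbb.
Qed.

Lemma Some_imageE (T : Type) (A : set T) (x : T) : (Some @` A) (Some x) = A x.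
Proof. by apply/propext; split=> [[y Ay [<-]]|Ax] //; exists x. Qed.

Lemma None_notin_Some (T : Type) (A : set T) : ~ (Some @` A) None.
Proof. by case. Qed.

Lemma eucl_sphere_inj (R : realType) (c c' : 'rV[R]_3) (r r' : R) :
  r != 0 -> r' != 0 -> eucl_sphere c r = eucl_sphere c' r' ->
  c = c' /\ r = r'.
Proof.
move=> r0 r'0 [e1 e2].
have inS x : dot (x - c) (x - c) = r ^+ 2 -> dot (x - c') (x - c') = r' ^+ 2.
  by move=> xS; have := congr1 (@^~ (Some x)) e1;
     rewrite !Some_imageE /= => <-.
have cc : c = c'.
  apply/eqP; rewrite -subr_eq0; apply/eqP/rowP => i; rewrite mxE.
  have de : dot (delta_mx 0 i) (delta_mx 0 i) = 1 :> R.
    rewrite /dot (bigD1 i) //= !mxE !eqxx mulr1 big1 ?addr0 // => j ji.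
    by rewrite !mxE (negPf ji) /= mulr0.
  have dx x : dot x (delta_mx 0 i) = x 0 i :> R.
    rewrite /dot (bigD1 i) //= !mxE !eqxx mulr1 big1 ?addr0 // => j ji.
    by rewrite !mxE (negPf ji) /= mulr0.
  have P k : dot (c + k *: delta_mx 0 i - c) (c + k *: delta_mx 0 i - c)
           = k ^+ 2.
    by rewrite addrC addKr dotZr dotC dotZr de; ring.
  have Q k : dot (c + k *: delta_mx 0 i - c') (c + k *: delta_mx 0 i - c')
           = dot (c - c') (c - c') + 2 * k * (c - c') 0 i + k ^+ 2.
    rewrite (addrAC c) (dot_sqrD (c - c')) !dotZr (dotC (_ *: _) (delta_mx _ _)) dotZr de dx.
    by ring.
  have := inS _ (P r); rewrite Q => h1.
  have := inS (c + (- r) *: delta_mx 0 i); rewrite P sqrrN => /(_ erefl).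
  rewrite Q => h2.
  have /eqP : r * (c - c') 0 i = 0 by nra.
  by rewrite mulf_eq0 (negPf r0) /= => /eqP; rewrite !mxE.
split=> //; subst c'.
have rr : r ^+ 2 = r' ^+ 2.
  pose x := c + r *: delta_mx 0 (inord 0) : 'rV[R]_3.
  have xS : dot (x - c) (x - c) = r ^+ 2.
    rewrite /x addrC addKr dotE !mxE !eqxx /=.
    by rewrite -!val_eqE /= !inordK //=; ring.
  by rewrite -xS; apply: inS.
have := congr1 (@^~ None) e2; move/eqP: rr; rewrite eqf_sqr => /orP[/eqP//|/eqP E].
have [r0'|r0'] := ltP 0 r; have [r1|r1] := ltP 0 r'; try lra.
- by move=> H; exfalso; apply: (@None_notin_Some _ [set x | dot (x - c) (x - c) < r ^+ 2]);
    move: H => /= ->; left.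
- by move=> H; exfalso; apply: (@None_notin_Some _ [set x | dot (x - c) (x - c) < r' ^+ 2]);
    move: H => /= <-; left.
Qed.

Lemma oplane_inj (R : realType) (n n' : 'rV[R]_3) (h h' : R) :
  dot n n = 1 -> dot n' n' = 1 -> oplane n h = oplane n' h' ->
  n = n' /\ h = h'.
Proof.
move=> n1 n'1 [e1 e2].
have inS x : dot n x = h -> dot n' x = h'.
  move=> xS.
  have : ((None |` (Some @` [set x | dot n x = h])) (Some x)) by right; exists x.
  by rewrite e1 => -[//|[y /= + [<-]]].
have inB x : h < dot n x -> h' < dot n' x.
  by move=> xS; have := congr1 (@^~ (Some x)) e2; rewrite !Some_imageE /= => <-.
set d := dot n' n.
have dC : dot n n' = d by rewrite dotC.
have h1 : h * d = h'.
  by rewrite -(inS (h *: n)) ?dotZr // n1 mulr1.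
have h2 : 1 - d ^+ 2 = 0.
  have := inS (h *: n + (n' - d *: n)).
  rewrite !(dotDr _ (h *: n)) !dotBr !dotZr n1 n'1 dC -/d.
  have -> : h * 1 + (d - d * 1) = h by ring.
  by move=> /(_ erefl); lra.
have h3 : 0 < d.
  have := inB ((h + 1) *: n); rewrite !dotZr n1 -/d => H.
  have : h' < (h + 1) * d by apply: H; lra.
  by rewrite -h1 mulrDl mul1r; lra.
have d1 : d = 1.
  have : (1 - d) * (1 + d) = 0 by nra.
  by move/eqP; rewrite mulf_eq0 => /orP[] /eqP; lra.
split; last by move: h1; rewrite d1; lra.
apply/eqP; rewrite -subr_eq0; apply/eqP/dot_eq0.
rewrite dotBr (dotC (n - n') n) (dotC (n - n') n') !dotBr n1 n'1 dC -/d d1.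
by lra.
Qed.

Lemma eucl_neq_oplane (R : realType) (c n : 'rV[R]_3) (r h : R) :
  eucl_sphere c r <> oplane n h.
Proof.
move=> [e _]; apply: (@None_notin_Some _ [set x | dot (x - c) (x - c) = r ^+ 2]).
by rewrite e; left.
Qed.

Lemma inversive_coords_inj (R : realType) (s : osphere R) (v w : 'rV[R]_5) :
  inversive_coords s v -> inversive_coords s w -> v = w.
Proof.
suff H t : inversive_coords t w -> forall s, inversive_coords s v ->
    s = t -> v = w by move=> sv sw; apply: (H _ sw _ sv).
case=> [c r r0|n h n1] {}s [c' r' r0'|n' h' n1'] E.
- by have [-> ->] := eucl_sphere_inj r0' r0 E.
- by have := @eucl_neq_oplane R c n' r h'; rewrite E.
- by have := @eucl_neq_oplane R c' n r' h; rewrite E.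
- by have [-> ->] := oplane_inj n1' n1 E.
Qed.

Lemma inversive_vecP (R : realType) (s : osphere R) (v : 'rV[R]_5) :
  inversive_coords s v -> inversive_vec s = v.
Proof.
by move=> sv; apply: inversive_coords_inj (sv); apply: xgetI sv.
Qed.

(* Main.v *)
(* Identify the oriented sphere with coordinates (a, b, w) with the sign of
   the function x |-> b|x|^2 - 2 w.x + a, whose value at infinity is b. An
   inversion in the sphere with coordinates m pulls this function back, up to a
   positive factor, to that of the Lorentz reflection of (a, b, w) along m;
   hence every Moebius transformation acts additively on coordinates. Two
   spheres with Lorentz product -1 meet, so the disjoint pairs of an admissible
   ordering come from the antipodal pairs of the standard configuration, each
   of which has coordinate sum (2, 2, 0, 0, 0). *)
Require Import Defs.
From HB Require Import structures.
From mathcomp Require Import all_boot all_order all_algebra.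
From mathcomp Require Import all_classical reals.
From mathcomp Require Import ring lra.

Set Implicit Arguments.
Unset Strict Implicit.
Unset Printing Implicit Defensive.

Import Order.TTheory GRing.Theory Num.Theory.

Local Open Scope classical_set_scope.
Local Open Scope ring_scope.

(** * The Lorentz form and reflections on coordinate vectors *)

(** Polarization of the quadratic form |w|^2 - ab on vectors (a, b, w), of signature (4, 1). *)
Definition lorentz (R : realType) (u v : 'rV[R]_5) : R :=
  u 0 (inord 2) * v 0 (inord 2) + u 0 (inord 3) * v 0 (inord 3)
  + u 0 (inord 4) * v 0 (inord 4)
  - (u 0 (inord 0) * v 0 (inord 1) + u 0 (inord 1) * v 0 (inord 0)) / 2.

Definition sphere_fun (R : realType) (v : 'rV[R]_5) (p : hatR3 R) : R :=
  if p is Some x then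
    v 0 (inord 1) * dot x x
    - 2 * (v 0 (inord 2) * x 0 (inord 0) + v 0 (inord 3) * x 0 (inord 1)
           + v 0 (inord 4) * x 0 (inord 2)) + v 0 (inord 0)
  else v 0 (inord 1).

Arguments sphere_fun : simpl never.

Definition sphere_of (R : realType) (v : 'rV[R]_5) : osphere R :=
  ([set p | sphere_fun v p = 0], [set p | sphere_fun v p < 0]).

Definition lorentz_refl (R : realType) (m v : 'rV[R]_5) : 'rV[R]_5 :=
  v - (2 * lorentz v m) *: m.

Lemma coord_vecE (R : realType) (a b : R) (w : 'rV[R]_3) :
  (coord_vec a b w 0 (inord 0) = a) * (coord_vec a b w 0 (inord 1) = b)
  * (coord_vec a b w 0 (inord 2) = w 0 (inord 0))
  * (coord_vec a b w 0 (inord 3) = w 0 (inord 1))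
  * (coord_vec a b w 0 (inord 4) = w 0 (inord 2)).
Proof. by rewrite /coord_vec !mxE !inordK. Qed.

Lemma rV5P (R : realType) (u v : 'rV[R]_5) :
  u 0 (inord 0) = v 0 (inord 0) -> u 0 (inord 1) = v 0 (inord 1) ->
  u 0 (inord 2) = v 0 (inord 2) -> u 0 (inord 3) = v 0 (inord 3) ->
  u 0 (inord 4) = v 0 (inord 4) -> u = v.
Proof.
move=> h0 h1 h2 h3 h4; apply/rowP => i; rewrite -(inord_val i).
by case: i => [[|[|[|[|[|]]]]]].
Qed.

Lemma rV3P (R : realType) (u v : 'rV[R]_3) :
  u 0 (inord 0) = v 0 (inord 0) -> u 0 (inord 1) = v 0 (inord 1) ->
  u 0 (inord 2) = v 0 (inord 2) -> u = v.
Proof.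
move=> h0 h1 h2; apply/rowP => i; rewrite -(inord_val i).
by case: i => [[|[|[|]]]].
Qed.

Lemma lorentz_reflE (R : realType) (m v : 'rV[R]_5) (i : 'I_5) :
  lorentz_refl m v 0 i = v 0 i - 2 * lorentz v m * m 0 i.
Proof. by rewrite !mxE. Qed.

Lemma lorentz_refl_norm (R : realType) (m v : 'rV[R]_5) :
  lorentz m m = 1 ->
  lorentz (lorentz_refl m v) (lorentz_refl m v) = lorentz v v.
Proof.
move=> m1.
(* A free scalar [k] keeps the expansion small; at [k = lorentz v m] the last two terms cancel. *)
have E k : lorentz (v - (2 * k) *: m) (v - (2 * k) *: m)
    = lorentz v v - 4 * k * lorentz v m + 4 * k ^+ 2 * lorentz m m.
  by rewrite /lorentz !mxE; field.
by rewrite /lorentz_refl E m1; ring.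
Qed.

Lemma lorentz_reflD (R : realType) (m u v : 'rV[R]_5) :
  lorentz_refl m (u + v) = lorentz_refl m u + lorentz_refl m v.
Proof.
by apply: rV5P; rewrite /lorentz_refl /lorentz !mxE; field.
Qed.

(** * Oriented spheres as unit vectors of the Lorentz form *)

Lemma sphere_fun_eucl (R : realType) (c x : 'rV[R]_3) (r : R) : r != 0 ->
  sphere_fun (coord_vec (r^-1 * dot c c - r^-1^-1) r^-1 (r^-1 *: c)) (Some x)
  = r^-1 * (dot (x - c) (x - c) - r ^+ 2).
Proof. by move=> r0; rewrite /sphere_fun !coord_vecE !dotE !mxE; field. Qed.

Lemma sphere_fun_plane (R : realType) (n x : 'rV[R]_3) (h : R) :
  sphere_fun (coord_vec (2 * h) 0 n) (Some x) = 2 * (h - dot n x).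
Proof. by rewrite /sphere_fun !coord_vecE !dotE; ring. Qed.

(** The function is (|x - c|^2 - r^2) / r or 2 (h - n.x). Division by the signed radius makes it
    negative exactly on the orienting region for both orientations, and its value 1/r at infinity is
    negative exactly when the region is the exterior. *)
Lemma inversive_coords_sphere_of (R : realType) (s : osphere R)
    (v : 'rV[R]_5) :
  inversive_coords s v -> s = sphere_of v /\ lorentz v v = 1.
Proof.
case=> [c r r0|n h n1] /=; split.
- rewrite /eucl_sphere /sphere_of; congr pair; apply/seteqP; split => -[x|].
  + by rewrite Some_imageE /= sphere_fun_eucl // => ->; rewrite subrr mulr0.
  + by move/None_notin_Some.
  + rewrite Some_imageE /= sphere_fun_eucl // => /eqP.
    by rewrite mulf_eq0 invr_eq0 (negPf r0) subr_eq0 => /eqP.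
  + by rewrite /= /sphere_fun coord_vecE => /eqP; rewrite invr_eq0 (negPf r0).
  + case: (ltP 0 r) => r1; rewrite /= sphere_fun_eucl //.
    * move=> [y yB [<-]].
      by rewrite pmulr_rlt0 ?invr_gt0 // subr_lt0.
    * move=> [//|[y yB [<-]]].
      by rewrite nmulr_rlt0 ?invr_lt0 ?subr_gt0 // lt_neqAle r0.
  + case: (ltP 0 r) => r1 /=; first by case.
    by rewrite /sphere_fun coord_vecE invr_lt0 lt_neqAle r0.
  + rewrite /= sphere_fun_eucl //; case: (ltP 0 r) => r1.
    * rewrite pmulr_rlt0 ?invr_gt0 // subr_lt0 => xB; by exists x.
    * rewrite nmulr_rlt0 ?invr_lt0 ?subr_gt0; last by rewrite lt_neqAle r0.
      by move=> xB; right; exists x.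
  + rewrite /= /sphere_fun coord_vecE invr_lt0; case: (ltP 0 r) => r1; last by left.
    by rewrite ltNge (ltW r1).
- by rewrite /lorentz !coord_vecE dotE !mxE; field.
- rewrite /oplane /sphere_of; congr pair; apply/seteqP; split => -[x|] /=.
  + by rewrite sphere_fun_plane => -[//|[y yS [<-]]]; rewrite yS subrr mulr0.
  + by rewrite /sphere_fun coord_vecE.
  + by rewrite sphere_fun_plane => xS; right; exists x => //=; lra.
  + by left.
  + by rewrite sphere_fun_plane => -[y yS [<-]]; lra.
  + by case.
  + by rewrite sphere_fun_plane => xS; exists x => //=; lra.
  + by rewrite /sphere_fun coord_vecE ltxx.
- by rewrite -n1 /lorentz !coord_vecE dotE; field.
Qed.

Lemma sphere_of_inversive_coords (R : realType) (v : 'rV[R]_5) :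
  lorentz v v = 1 -> inversive_coords (sphere_of v) v.
Proof.
move=> v1.
(* By the previous lemma, any sphere with these coordinates equals [sphere_of v]. For bend 0 it is a
   plane with normal w and h = a/2; otherwise it has center w/b and radius 1/b, and the norm
   condition determines a. *)
suff [s sv] : exists s, inversive_coords s v.
  by have [<-] := inversive_coords_sphere_of sv.
have [w wE] : exists w : 'rV[R]_3,
    ((w 0 (inord 0) = v 0 (inord 2)) * (w 0 (inord 1) = v 0 (inord 3))
     * (w 0 (inord 2) = v 0 (inord 4)))%type.
  by exists (\row_(j < 3) v 0 (inord j.+2)); rewrite !mxE !inordK.
have [b0|b0] := eqVneq (v 0 (inord 1)) 0.
- pose h := v 0 (inord 0) / 2; exists (oplane w h).
  have -> : v = coord_vec (2 * h) 0 w.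
    by apply: rV5P; rewrite !coord_vecE ?wE // /h; field.
  apply: Inv_plane; rewrite dotE !wE.
  by move: v1; rewrite /lorentz b0; lra.
- set b := v 0 (inord 1) in b0 *.
  exists (eucl_sphere (b^-1 *: w) b^-1).
  have bV : b^-1 != 0 by rewrite invr_eq0.
  suff -> : v = coord_vec (b * dot (b^-1 *: w) (b^-1 *: w) - b^-1) b
                    (b *: (b^-1 *: w)).
    by have := Inv_eucl (b^-1 *: w) bV; rewrite /= invrK.
  apply: rV5P; rewrite !coord_vecE ?dotE ?mxE ?wE //; try by field.
  move: v1; rewrite /lorentz -/b => v1.
  apply: (mulfI b0); rewrite mulrBr divff //.
  have -> : 1 = v 0 (inord 2) * v 0 (inord 2) + v 0 (inord 3) * v 0 (inord 3)
     + v 0 (inord 4) * v 0 (inord 4) - v 0 (inord 0) * b by rewrite -v1; field.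
  by field.
Qed.

(** * Moebius transformations acting on coordinates *)

(** Images under an involution are preimages, and a positive factor changes neither the zero set nor
    the sign. *)
Lemma sphere_image_refl (R : realType) (f : hatR3 R -> hatR3 R)
    (m v : 'rV[R]_5) (k : hatR3 R -> R) : involutive f ->
  (forall p, 0 < k p) ->
  (forall p, sphere_fun v (f p) = k p * sphere_fun (lorentz_refl m v) p) ->
  sphere_image f (sphere_of v) = sphere_of (lorentz_refl m v).
Proof.
move=> fK k0 H; rewrite /sphere_image /sphere_of /=.
have imE (A : set (hatR3 R)) : f @` A = [set p | A (f p)].
  by apply/seteqP; split=> [_ [p Ap <-]|p Ap] /=; [rewrite fK|exists (f p)].
rewrite !imE /=; congr pair; apply/seteqP; split=> p /=; rewrite H.
- by move/eqP; rewrite mulf_eq0 gt_eqF // => /eqP.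
- by move->; rewrite mulr0.
- by rewrite pmulr_rlt0.
- by rewrite pmulr_rlt0.
Qed.

Lemma dot_gt0 (R : realType) (x : 'rV[R]_3) : x != 0 -> 0 < dot x x.
Proof.
move=> x0; rewrite lt_neqAle eq_sym; apply/andP; split.
  by apply: contraNneq x0 => /dot_eq0 ->.
by rewrite dotE; rewrite -!expr2 !addr_ge0 // sqr_ge0.
Qed.

Lemma sphere_inversionK (R : realType) (c : 'rV[R]_3) (r : R) :
  0 < r -> involutive (sphere_inversion c r).
Proof.
move=> r0 [x|] /=; last by rewrite eqxx.
have [->//|xc] := eqVneq x c.
have u0 : 0 < dot (x - c) (x - c) by rewrite dot_gt0 // subr_eq0.
rewrite /=; set k := _ / _.
have E : c + k *: (x - c) - c = k *: (x - c) by rewrite addrC addKr.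
rewrite -subr_eq0 E.
have k0 : 0 < k by rewrite divr_gt0 // exprn_gt0.
rewrite scaler_eq0 (gt_eqF k0) subr_eq0 (negPf xc) /=.
congr Some; rewrite !dotZr dotC dotZr scalerA.
have -> : r ^+ 2 / (k * (k * dot (x - c) (x - c))) * k = 1.
  by rewrite /k; field; rewrite !gt_eqF.
by rewrite scale1r addrC subrK.
Qed.

Lemma plane_reflectionK (R : realType) (n : 'rV[R]_3) (h : R) :
  dot n n = 1 -> involutive (plane_reflection n h).
Proof.
move=> n1 [x|] //=; congr Some; rewrite dotBr dotZr n1.
by apply: rV3P; rewrite !mxE; ring.
Qed.

(** The conformal factor of the inversion. The values at the center and at infinity are limits,
    taken after dividing [sphere_fun] by |x|^2 near infinity. *)
Definition inversion_scale (R : realType) (c : 'rV[R]_3) (r : R)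
    (p : hatR3 R) : R :=
  if p is Some x then
    if x == c then r ^- 2 else r ^+ 2 / dot (x - c) (x - c)
  else r ^+ 2.

Lemma inversion_scale_gt0 (R : realType) (c : 'rV[R]_3) (r : R)
    (p : hatR3 R) : 0 < r -> 0 < inversion_scale c r p.
Proof.
move=> r0; case: p => [x|] /=; last by rewrite exprn_gt0.
have [_|xc] := eqVneq x c; first by rewrite invr_gt0 exprn_gt0.
by rewrite divr_gt0 ?exprn_gt0 // dot_gt0 // subr_eq0.
Qed.

Lemma sphere_fun_inversion (R : realType) (c : 'rV[R]_3) (r : R)
    (v : 'rV[R]_5) : 0 < r ->
  let m := coord_vec (r^-1 * dot c c - r^-1^-1) r^-1 (r^-1 *: c) in
  forall p, sphere_fun v (sphere_inversion c r p) =
    inversion_scale c r p * sphere_fun (lorentz_refl m v) p.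
Proof.
move=> r0 m p; rewrite /inversion_scale; case: p => [x|] /=.
- have [->|xc] := eqVneq x c.
    rewrite /sphere_fun /= !lorentz_reflE /m /lorentz !coord_vecE dotE !mxE.
    by field; rewrite gt_eqF.
  (* The inequality stays in the goal so that it is expanded into coordinates too and matches the
     side condition of [field]. *)
  have : 0 < dot (x - c) (x - c) by rewrite dot_gt0 // subr_eq0.
  rewrite /sphere_fun /= !lorentz_reflE /m /lorentz !coord_vecE !dotE !mxE => u0.
  by field; rewrite !gt_eqF.
- rewrite /sphere_fun /= !lorentz_reflE /m /lorentz !coord_vecE dotE !mxE.
  by field; rewrite gt_eqF.
Qed.

Lemma sphere_fun_reflection (R : realType) (n : 'rV[R]_3) (h : R)
    (v : 'rV[R]_5) : dot n n = 1 ->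
  forall p, sphere_fun v (plane_reflection n h p) =
    sphere_fun (lorentz_refl (coord_vec (2 * h) 0 n) v) p.
Proof.
move=> n1 [x|]; rewrite /sphere_fun /=.
- set k := 2 * (dot n x - h).
  (* The factor |n|^2 is isolated here so that it can be replaced by 1 before the expansion into
     coordinates. *)
  have -> : dot (x - k *: n) (x - k *: n)
          = dot x x - 2 * k * dot n x + k ^+ 2 * dot n n.
    by rewrite !dotE !mxE; ring.
  rewrite n1 /k.
  by rewrite !lorentz_reflE /lorentz !coord_vecE !dotE !mxE; field.
- by rewrite !lorentz_reflE /lorentz !coord_vecE; field.
Qed.

(** The map [g] is the product of the Lorentz reflections along the generators of [f]; its
    additivity is what transports sums of antipodal coordinates. *)
Lemma moebius_coords (R : realType) (f : hatR3 R -> hatR3 R) : moebius f ->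
  exists g : 'rV[R]_5 -> 'rV[R]_5, {morph g : u v / u + v} /\
    forall s v, inversive_coords s v -> inversive_coords (sphere_image f s) (g v).
Proof.
(* The induction step common to both kinds of generator; plane reflections are isometries and take
   [l] constantly 1. *)
have step (h k : hatR3 R -> hatR3 R) (l : hatR3 R -> R) (m : 'rV[R]_5) :
    involutive h -> (forall p, 0 < l p) -> lorentz m m = 1 ->
    (forall v p, sphere_fun v (h p)
                 = l p * sphere_fun (lorentz_refl m v) p) ->
    (exists g : 'rV[R]_5 -> 'rV[R]_5, {morph g : u v / u + v} /\
      forall s v, inversive_coords s v ->
        inversive_coords (sphere_image k s) (g v)) ->
    exists g : 'rV[R]_5 -> 'rV[R]_5, {morph g : u v / u + v} /\
      forall s v, inversive_coords s v ->
        inversive_coords (sphere_image (h \o k) s) (g v).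
  move=> hK l0 m1 H [g [gD gP]].
  exists (lorentz_refl m \o g); split=> [u v|s v /gP sv] /=.
    by rewrite gD lorentz_reflD.
  have [E v1] := inversive_coords_sphere_of sv.
  have -> : sphere_image (h \o k) s = sphere_image h (sphere_image k s).
    by rewrite /sphere_image /= !image_comp.
  rewrite E (sphere_image_refl hK l0 (H _)).
  by apply: sphere_of_inversive_coords; rewrite lorentz_refl_norm.
elim=> [|c r {}f r0 _ IH|n h {}f n1 _ IH].
- exists id; split=> // s v.
  by rewrite /sphere_image !image_id; case: s.
- have [_ m1] := inversive_coords_sphere_of (Inv_eucl c (lt0r_neq0 r0)).
  apply: (step _ _ (inversion_scale c r) _ _ _ m1) IH => [|p|v p].
  + exact: sphere_inversionK.
  + exact: inversion_scale_gt0.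
  + exact: sphere_fun_inversion.
- have [_ m1] := inversive_coords_sphere_of (Inv_plane h n1).
  apply: (step _ _ (fun=> 1) _ _ _ m1) IH => // [|v p].
  + exact: plane_reflectionK.
  + by rewrite mul1r sphere_fun_reflection.
Qed.

(** * Tangency in terms of the Lorentz form *)

(* The sum u + v is isotropic; it represents the point sphere at the tangency
   point. With nonnegative bends, a sum of bend 0 forces both surfaces to be
   planes, which meet at infinity. *)
Lemma tangent_spheres_meet (R : realType) (u v : 'rV[R]_5) :
  lorentz u u = 1 -> lorentz v v = 1 -> lorentz u v = -1 ->
  0 <= u 0 (inord 1) -> 0 <= v 0 (inord 1) ->
  exists p, (sphere_of u).1 p /\ (sphere_of v).1 p.
Proof.
move=> uu vv uv u0 v0; set b := u 0 (inord 1) + v 0 (inord 1).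
have [b0|b0] := eqVneq b 0.
  by exists None; rewrite /= /sphere_fun; move: b0; rewrite /b; split; lra.
have [w [w0 w1 w2]] : exists w : 'rV[R]_3,
    [/\ w 0 (inord 0) = u 0 (inord 2) + v 0 (inord 2),
        w 0 (inord 1) = u 0 (inord 3) + v 0 (inord 3)
      & w 0 (inord 2) = u 0 (inord 4) + v 0 (inord 4)].
  by exists (\row_(j < 3) (u 0 (inord j.+2) + v 0 (inord j.+2)));
    rewrite !mxE !inordK.
have E : lorentz u u + 2 * lorentz u v + lorentz v v = 0.
  by rewrite uu vv uv; ring.
exists (Some (b^-1 *: w)); split; rewrite /= /sphere_fun dotE !mxE w0 w1 w2.
(* The value is a combination of the products of u + v with itself and with u, both of which
   vanish. *)
- transitivity (u 0 (inord 1) / b ^+ 2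
      * (lorentz u u + 2 * lorentz u v + lorentz v v)
    - 2 / b * (lorentz u u + lorentz u v)).
    by rewrite /lorentz /b; field.
  by rewrite E uu uv; ring.
- transitivity (v 0 (inord 1) / b ^+ 2
      * (lorentz u u + 2 * lorentz u v + lorentz v v)
    - 2 / b * (lorentz v v + lorentz u v)).
    by rewrite /lorentz /b; field.
  by rewrite E vv uv; ring.
Qed.

(** * Lorentz products and antipodal sums in the standard configuration *)

Lemma std_mxE (R : realType) (k : 'I_8) (j : nat) : (j < 5)%N ->
  row k (std_mx R) 0 (inord j) =
  (nth [::] [:: [:: 2; 0;   0;   0;  1];
       [:: 2; 0;   0;   0; -1];
       [:: 1; 1;   Num.sqrt 2;   0;  0];
       [:: 1; 1;   0;   Num.sqrt 2;  0];
       [:: 0; 2;   0;   0; -1];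
       [:: 0; 2;   0;   0;  1];
       [:: 1; 1; - Num.sqrt 2;   0;  0];
       [:: 1; 1;   0; - Num.sqrt 2;  0]] k)`_j.
Proof. by move=> j5; rewrite !mxE inordK. Qed.

Lemma ord8_ind (P : 'I_8 -> Prop) : P (inord 0) -> P (inord 1) ->
  P (inord 2) -> P (inord 3) -> P (inord 4) -> P (inord 5) -> P (inord 6) ->
  P (inord 7) -> forall k, P k.
Proof.
move=> ? ? ? ? ? ? ? ? k; rewrite -(inord_val k).
by case: k => [[|[|[|[|[|[|[|[|]]]]]]]]].
Qed.

Lemma std_lorentz (R : realType) (k l : 'I_8) :
  (k != l %[mod 4])%N ->
  lorentz (row k (std_mx R)) (row l (std_mx R)) = -1.
Proof.
have : Num.sqrt 2 ^+ 2 = 2 :> R by rewrite sqr_sqrtr.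
rewrite /lorentz !std_mxE //.
(* The root becomes an atom of which only the square is known. *)
move: (Num.sqrt 2) => q q2.
elim/ord8_ind: k; elim/ord8_ind: l; rewrite !inordK //= => _;
  rewrite ?(mulr0, mul0r, mulr1, mul1r, addr0, add0r, mulrNN); lra.
Qed.

Lemma std_norm (R : realType) (k : 'I_8) :
  lorentz (row k (std_mx R)) (row k (std_mx R)) = 1.
Proof.
have : Num.sqrt 2 ^+ 2 = 2 :> R by rewrite sqr_sqrtr.
rewrite /lorentz !std_mxE //.
move: (Num.sqrt 2) => q q2.
by elim/ord8_ind: k; rewrite !inordK //=; lra.
Qed.

Lemma std_bend_ge0 (R : realType) (k : 'I_8) :
  0 <= row k (std_mx R) 0 (inord 1).
Proof. by rewrite std_mxE //; elim/ord8_ind: k; rewrite !inordK //=. Qed.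

Lemma std_antipodal (R : realType) (k l : 'I_8) :
  k != l -> (k == l %[mod 4])%N ->
  row k (std_mx R) + row l (std_mx R) = coord_vec 2 2 0.
Proof.
move=> kl E; have {}kl : (k : nat) != l by [].
move: kl E; elim/ord8_ind: k; elim/ord8_ind: l; rewrite !inordK //= => _ _;
  apply: rV5P; rewrite coord_vecE [LHS]mxE !std_mxE // !inordK //= ?mxE; ring.
Qed.

(** * Antipodal pairs of an admissible ordering *)

Lemma admissible_antipodal (R : realType) (C : set (osphere R))
    (S : 'I_8 -> osphere R) :
  orthoplicial C -> admissible_ordering C S ->
  exists e, forall i j : 'I_8, i != j -> (i == j %[mod 4])%N ->
    inversive_vec (S i) + inversive_vec (S j) = e.
Proof.
move=> [f fM CE] [[S_C S_inj _] adm].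
have [g [gD gP]] := moebius_coords fM.
have stdP k := sphere_of_inversive_coords (std_norm R k).
have ex_row i : exists k,
    S i = sphere_image f (sphere_of (row k (std_mx R))).
  have := S_C i I; rewrite CE => -[t [k tk] <-].
  by exists k; have [<-] := inversive_coords_sphere_of tk.
(* The relabelling [s] sends each index to a standard row; a priori it need not respect classes
   modulo 4. *)
have [s sE] := choice ex_row.
exists (g (coord_vec 2 2 0)) => i j ij ij4.
rewrite !sE !(inversive_vecP (gP _ _ (stdP _))) -gD std_antipodal //.
  apply: contraNneq ij => sij; apply/eqP/S_inj; rewrite ?inE //.
  by rewrite !sE sij.
(* Were the two rows not antipodal, their standard spheres would share a point [p], and [f p] would
   lie on both of the disjoint spheres [S i] and [S j]. *)
apply: contraTT isT => sij4; have := adm i j ij; rewrite ij4.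
have [p [pi pj]] := tangent_spheres_meet (std_norm R _) (std_norm R _)
  (std_lorentz R sij4) (std_bend_ge0 R _) (std_bend_ge0 R _).
rewrite /disjoint_spheres !sE => /seteqP[/(_ (f p)) H _].
by exfalso; apply: H; split; exists p.
Qed.

Theorem corollary3p5 (R : realType) (C : set (osphere R))
    (S : 'I_8 -> osphere R) :
  orthoplicial C -> admissible_ordering C S ->
  let v := fun k : nat => inversive_vec (S (inord k)) in
  [/\ antipodal_vec S = 2^-1 *: (v 0%N + v 4%N),
      antipodal_vec S = 2^-1 *: (v 1%N + v 5%N),
      antipodal_vec S = 2^-1 *: (v 2%N + v 6%N),
      antipodal_vec S = 2^-1 *: (v 3%N + v 7%N)
    & V_mx S = D_mx R *m F_mx S].
Proof.
move=> orthC admS v.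
have [e eP] := admissible_antipodal orthC admS.
have sumE k : (k < 4)%N -> v k + v k.+4 = e.
  move=> k4; have k8 : (k < 8)%N by rewrite (ltn_trans k4).
  apply: eP; last by rewrite !inordK // -addn4 modnDr.
  by rewrite -val_eqE /= !inordK // -addn4 -[X in X != _]addn0 eqn_add2l.
have muE : antipodal_vec S = 2^-1 *: e by rewrite -(sumE 0%N).
split; rewrite ?sumE //.
(* Entrywise, the first four rows are trivial and the last four say that a vector is twice the
   antipodal vector minus its partner. *)
apply/matrixP => k j; rewrite !mxE !big_ord_recl big_ord0 !mxE /=.
rewrite /bump /= !add1n.
have sum_j l : (l < 4)%N -> v l 0 j + v l.+4 0 j = e 0 j.
  by move=> l4; rewrite -(sumE l l4) [RHS]mxE.
have s0 := sum_j 0%N isT; have s1 := sum_j 1%N isT.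
have s2 := sum_j 2%N isT; have s3 := sum_j 3%N isT.
(* Folding back to [v] gives [lra] the same atoms as in the four sums. *)
by elim/ord8_ind: k; rewrite !inordK //= -?[inversive_vec (S (inord _))]/(v _);
  lra.
Qed.
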